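(* Let $\chi$ and $\check\phi$ be formulas over $\vec{x}$ and $\vec{a}:\mathbb{Z}^d\to\mathbb{Z}^d$ such that for all $\vec{x}\in\mathbb{Z}^d$: $\check\phi(\vec{x})\land\chi(\vec{a}(\vec{x}))\implies\chi(\vec{x})$. Then the conditional acceleration technique $(\langle\chi,\vec{a}\rangle,\check\phi)\mapsto \vec{x}'=\vec{a}^n(\vec{x})\land\chi(\vec{a}^{n-1}(\vec{x}))$ (defined on all such pairs) is exact. Explicitly: for all $\vec{x},\vec{x}'\in\mathbb{Z}^d$ and $n>0$, (i) if $\vec{x}\longrightarrow^n_{\langle\check\phi,\vec{a}\rangle}\vec{x}'$, $\vec{x}'=\vec{a}^n(\vec{x})$ and $\chi(\vec{a}^{n-1}(\vec{x}))$, then $\vec{x}\longrightarrow^n_{\langle\chi,\vec{a}\rangle}\vec{x}'$; and (ii) if $\vec{x}\longrightarrow^n_{\langle\chi\land\check\phi,\vec{a}\rangle}\vec{x}'$, then $\vec{x}'=\vec{a}^n(\vec{x})$ and $\chi(\vec{a}^{n-1}(\vec{x}))$.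
   Context: $\vec{x}=(x_1,\dots,x_d)$ ranges over $\mathbb{Z}^d$, $n$ is a variable, $\vec{x}'=(x_1',\dots,x_d')$. Formulas are finite quantifier-free propositional formulas with atoms $p>0$, $p$ a closed-form arithmetic expression. For a formula $\phi$ over $\vec{x}$ and $\vec{a}:\mathbb{Z}^d\to\mathbb{Z}^d$, the loop $\langle\phi,\vec{a}\rangle$ induces $\vec{x}\longrightarrow_{\langle\phi,\vec{a}\rangle}\vec{x}'$ iff $\phi(\vec{x})\land\vec{x}'=\vec{a}(\vec{x})$; $\longrightarrow^n$ is its $n$-fold composition, and $\vec{a}^n$ is the $n$-fold application of $\vec{a}$ ($\vec{a}^0=\mathrm{id}$). A conditional acceleration technique is a partial function $\mathit{accel}$ mapping pairs (loop $\langle\chi,\vec{a}\rangle$, formula $\check\phi$) to formulas over $(\vec{x},n,\vec{x}')$; it is sound if for all arguments in its domain, $\vec{x},\vec{x}'\in\mathbb{Z}^d$, $n>0$: $\vec{x}\longrightarrow^n_{\langle\check\phi,\vec{a}\rangle}\vec{x}'\land\mathit{accel}(\langle\chi,\vec{a}\rangle,\check\phi)$ implies $\vec{x}\longrightarrow^n_{\langle\chi,\vec{a}\rangle}\vec{x}'$; exact if additionally $\vec{x}\longrightarrow^n_{\langle\chi\land\check\phi,\vec{a}\rangle}\vec{x}'$ implies $\mathit{accel}(\langle\chi,\vec{a}\rangle,\check\phi)$. *)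

(* Defs.v *)
From mathcomp Require Import all_boot all_order all_algebra.

Set Implicit Arguments.
Unset Strict Implicit.
Unset Printing Implicit Defensive.

Import Order.TTheory GRing.Theory Num.Theory.
Local Open Scope ring_scope.

(* [formula R V]: finite propositional formulas with atoms p > 0, where [V] is
   the type of valuations of the variables. An expression p is given by its
   value as a function of the valuation: there is no canonical grammar of
   closed forms, and the iterates of an arbitrary update function have to be
   expressible. Expressions take values in an arbitrary ordered domain [R]
   (int, rat, the reals), since arithmetic on integer variables, e.g. division,
   may leave the integers. *)
Inductive formula (R : realDomainType) (V : Type) : Type :=
| Pos of V -> R
| Neg of formula R V
| Conj of formula R V & formula R V
| Disj of formula R V & formula R V.

Fixpoint sat (R : realDomainType) (V : Type) (phi : formula R V) (v : V) : bool :=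
  match phi with
  | Pos p => 0 < p v
  | Neg phi1 => ~~ sat phi1 v
  | Conj phi1 phi2 => sat phi1 v && sat phi2 v
  | Disj phi1 phi2 => sat phi1 v || sat phi2 v
  end.

Fixpoint subst (R : realDomainType) (V W : Type) (s : W -> V)
    (phi : formula R V) : formula R W :=
  match phi with
  | Pos p => Pos (fun w => p (s w))
  | Neg phi1 => Neg (subst s phi1)
  | Conj phi1 phi2 => Conj (subst s phi1) (subst s phi2)
  | Disj phi1 phi2 => Disj (subst s phi1) (subst s phi2)
  end.

Lemma sat_subst (R : realDomainType) (V W : Type) (s : W -> V)
  (phi : formula R V) (w : W) : sat (subst s phi) w = sat phi (s w).
Proof. by elim: phi => //= [phi ->|phi -> psi ->|phi -> psi ->]. Qed.

Definition Truth (R : realDomainType) (V : Type) : formula R V := Pos (fun=> 1).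

(* Equality of integer terms: s = t iff s - t + 1 > 0 and t - s + 1 > 0. *)
Definition EqInt (R : realDomainType) (V : Type) (s t : V -> int) : formula R V :=
  Conj (Pos (fun v => (s v - t v + 1)%:~R)) (Pos (fun v => (t v - s v + 1)%:~R)).

Definition EqVec (R : realDomainType) (V : Type) (d : nat)
    (s t : V -> 'rV[int]_d) : formula R V :=
  \big[@Conj R V/Truth R V]_(i < d)
    EqInt R (fun v => s v 0 i) (fun v => t v 0 i).

Lemma sat_EqInt (R : realDomainType) (V : Type) (s t : V -> int) (v : V) :
  sat (EqInt R s t) v = (s v == t v).
Proof.
rewrite /= !ltr0z !ltzD1 !subr_ge0.
by rewrite eq_le andbC.
Qed.

Lemma sat_EqVec (R : realDomainType) (V : Type) (d : nat)
  (s t : V -> 'rV[int]_d) (v : V) : sat (EqVec R s t) v = (s v == t v).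
Proof.
have sat1 : sat (Truth R V) v = true by rewrite /= ltr01.
rewrite /EqVec (big_morph (fun phi => sat phi v) (fun _ _ => erefl) sat1).
rewrite big_andE; apply/forallP/eqP => [st|st i]; last by rewrite sat_EqInt /= st eqxx.
by apply/rowP => i; apply/eqP; have := st i; rewrite sat_EqInt; apply.
Qed.

Record loop (R : realDomainType) (d : nat) : Type := Loop {
  guard : formula R 'rV[int]_d;
  update : 'rV[int]_d -> 'rV[int]_d
}.

Definition step (R : realDomainType) (d : nat) (l : loop R d)
    (x x' : 'rV[int]_d) : Prop :=
  sat (guard l) x /\ x' = update l x.

Fixpoint relpow (T : Type) (n : nat) (r : T -> T -> Prop) (x y : T) : Prop :=
  if n is m.+1 then exists2 z, r x z & relpow m r z y else x = y.

(* Valuations of the variables (x, n, x'). *)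
Definition accel_vars (d : nat) : Type := ('rV[int]_d * nat * 'rV[int]_d)%type.

(* A partial function, given by its domain and by a total function whose values
   outside of the domain are irrelevant. *)
Record cond_accel (R : realDomainType) (d : nat) : Type := CondAccel {
  accel_dom : loop R d -> formula R 'rV[int]_d -> Prop;
  accel_fun : loop R d -> formula R 'rV[int]_d -> formula R (accel_vars d)
}.

Definition accel_sound (R : realDomainType) (d : nat) (acc : cond_accel R d) : Prop :=
  forall (chi phi : formula R 'rV[int]_d) (a : 'rV[int]_d -> 'rV[int]_d),
    accel_dom acc (Loop chi a) phi ->
  forall (x x' : 'rV[int]_d) (n : nat), (0 < n)%N ->
    relpow n (step (Loop phi a)) x x' ->
    sat (accel_fun acc (Loop chi a) phi) (x, n, x') ->
    relpow n (step (Loop chi a)) x x'.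

Definition accel_exact (R : realDomainType) (d : nat) (acc : cond_accel R d) : Prop :=
  accel_sound acc /\
  forall (chi phi : formula R 'rV[int]_d) (a : 'rV[int]_d -> 'rV[int]_d),
    accel_dom acc (Loop chi a) phi ->
  forall (x x' : 'rV[int]_d) (n : nat), (0 < n)%N ->
    relpow n (step (Loop (Conj chi phi) a)) x x' ->
    sat (accel_fun acc (Loop chi a) phi) (x, n, x').

Definition cond_decreasing (R : realDomainType) (d : nat) (l : loop R d)
    (phi : formula R 'rV[int]_d) : Prop :=
  forall x : 'rV[int]_d,
    sat phi x /\ sat (guard l) (update l x) -> sat (guard l) x.

Definition decreasing_formula (R : realDomainType) (d : nat) (l : loop R d) :
    formula R (accel_vars d) :=
  Conj
    (EqVec R (fun v : accel_vars d => let: (x, n, x') := v in x')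
             (fun v : accel_vars d => let: (x, n, x') := v in iter n (update l) x))
    (subst (fun v : accel_vars d => let: (x, n, x') := v in iter n.-1 (update l) x)
           (guard l)).

Lemma sat_decreasing_formula (R : realDomainType) (d : nat) (l : loop R d)
    (x x' : 'rV[int]_d) (n : nat) :
  sat (decreasing_formula l) (x, n, x') <->
  x' = iter n (update l) x /\ sat (guard l) (iter n.-1 (update l) x).
Proof.
rewrite /= sat_EqVec sat_subst; split=> [/andP[/eqP -> ->] //|[-> ->]].
by rewrite eqxx.
Qed.

Definition decreasing_accel (R : realDomainType) (d : nat) : cond_accel R d :=
  CondAccel (@cond_decreasing R d) (fun l _ => decreasing_formula l).

(* Main.v *)
Require Import Defs.
From mathcomp Require Import all_boot all_order all_algebra.

(** The update is a function, so an [n]-fold run from [x] is just its orbit, with the guard true at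
    the iterates 0, ..., n-1 ([relpow_stepP]). For soundness, [phi] holds at all these points and
    [chi] at the last one; the hypothesis pulls [chi] back along the orbit, one iterate at a time
    ([cond_decreasing_iter]). Conversely, a run guarded by both formulas satisfies [chi] at iterate
    n-1 in particular. *)

Lemma relpow_stepP (R : realDomainType) (d : nat) (l : loop R d) (n : nat)
    (x x' : 'rV[int]_d) :
  relpow n (step l) x x' <->
  x' = iter n (update l) x /\
  (forall i, i < n -> sat (guard l) (iter i (update l) x)).
Proof.
elim: n x x' => [|n IHn] x x' /=; first by split=> [->|[]].
split=> [[z [gx ->] /IHn[-> gz]]|[-> gx]].
  by split=> [|[|i] // lt_in]; [rewrite -iterSr | rewrite iterSr; apply: gz].
exists (update l x); first by split=> //; apply: (gx 0).
by apply/IHn; split=> [|i lt_in]; rewrite -iterSr //; apply: gx.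
Qed.

(** Induction on [m]: [phi] at iterate [m] and the guard at its successor give the guard at iterate
    [m], whence the induction hypothesis covers the earlier ones. *)
Lemma cond_decreasing_iter (R : realDomainType) (d : nat) (l : loop R d)
    (phi : formula R 'rV[int]_d) (m : nat) (x : 'rV[int]_d) :
    cond_decreasing l phi ->
    (forall i, i < m -> sat phi (iter i (update l) x)) ->
    sat (guard l) (iter m (update l) x) ->
  forall i, i <= m -> sat (guard l) (iter i (update l) x).
Proof.
move=> decr; elim: m => [|m IHm] phix gm i; first by rewrite leqn0 => /eqP->.
rewrite leq_eqVlt => /predU1P[-> //|]; rewrite ltnS; apply: IHm => [j lt_jm|].
  exact/phix/ltnW.
by apply: decr; split; first exact: phix.
Qed.

Theorem theorem7 (R : realDomainType) (d : nat) :
  accel_exact (decreasing_accel R d).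
Proof.
(* The run length becomes [n.+1], so iterate [n] is the last point where the guard is tested. *)
split=> chi phi a decr x x' [//|n] _ /relpow_stepP[-> gx].
  move=> /sat_decreasing_formula[_ chin].
  apply/relpow_stepP; split=> // i; rewrite ltnS.
  apply: (cond_decreasing_iter _ _ _ _ _ _ decr) => // j lt_jn.
  exact/gx/ltnW.
by apply/sat_decreasing_formula; split=> //; have /andP[] := gx n (ltnSn n).
Qed.
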